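(* Let $\mathbb{H}_{\mathbb{Z}_3}(-1,-1)$ be the quaternion algebra over $\mathbb{Z}_3=\mathbb{Z}/3\mathbb{Z}$, and for $n\ge 0$ let $F_n=f_n+f_{n+1}i+f_{n+2}j+f_{n+3}k$ be the $n$-th Fibonacci quaternion, regarded as an element of $\mathbb{H}_{\mathbb{Z}_3}(-1,-1)$. Then $F_n$ is a zero divisor in $\mathbb{H}_{\mathbb{Z}_3}(-1,-1)$ for every $n\ge 0$, and the set $\{F_n : n\ge 0\}\subset \mathbb{H}_{\mathbb{Z}_3}(-1,-1)$ has exactly $8$ elements.
   Context: $(f_n)_{n\ge 0}$ is the Fibonacci sequence: $f_0=0$, $f_1=1$, $f_n=f_{n-1}+f_{n-2}$ for $n\ge 2$. For a prime $p$, $\mathbb{Z}_p=\mathbb{Z}/p\mathbb{Z}$ and $\mathbb{H}_{\mathbb{Z}_p}(-1,-1)$ is the 4-dimensional associative unital $\mathbb{Z}_p$-algebra with basis $\{1,i,j,k\}$ and relations $i^2=j^2=-1$, $k=ij=-ji$. Integer coefficients are reduced modulo $p$. An element $x$ of a ring is a zero divisor if there is a nonzero $y$ with $xy=0$ or $yx=0$ (so $0$ counts as a zero divisor). *)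

(* Defs.v *)
From HB Require Import structures.
From mathcomp Require Import all_boot all_algebra ring.

Set Implicit Arguments.
Unset Strict Implicit.
Unset Printing Implicit Defensive.

Import GRing.Theory.

Local Open Scope ring_scope.

Fixpoint fib (n : nat) : nat :=
  if n is m.+1 then (if m is l.+1 then fib m + fib l else 1)%N else 0%N.

Definition zero_divisor (R : pzRingType) (x : R) : Prop :=
  exists y : R, y != 0 /\ (x * y = 0 \/ y * x = 0).

(* [Quat x0 x1 x2 x3 : quaternion a b] stands for x0 + x1 i + x2 j + x3 k in
   H_R(a, b), where i^2 = a, j^2 = b and k = ij = -ji. *)
Record quaternion (R : comNzRingType) (a b : R) : Type :=
  Quat { qre : R; qim_i : R; qim_j : R; qim_k : R }.

Section Quaternion.
Variables (R : comNzRingType) (a b : R).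
Local Notation H := (quaternion a b).
Implicit Types x y z : H.

Definition quat_tuple x : R * R * R * R :=
  (qre x, qim_i x, qim_j x, qim_k x).
Definition tuple_quat (t : R * R * R * R) : H :=
  let: (x0, x1, x2, x3) := t in Quat a b x0 x1 x2 x3.

Lemma quat_tupleK : cancel quat_tuple tuple_quat.
Proof. by case. Qed.

HB.instance Definition _ := Choice.copy H (can_type quat_tupleK).

Definition quat_zero : H := Quat a b 0 0 0 0.
Definition quat_opp x : H :=
  Quat a b (- qre x) (- qim_i x) (- qim_j x) (- qim_k x).
Definition quat_add x y : H :=
  Quat a b (qre x + qre y) (qim_i x + qim_i y)
           (qim_j x + qim_j y) (qim_k x + qim_k y).

Lemma quat_addA : associative quat_add.
Proof. by move=> x y z; rewrite /quat_add /= !addrA. Qed.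
Lemma quat_addC : commutative quat_add.
Proof. by move=> x y; rewrite /quat_add; congr Quat; rewrite addrC. Qed.
Lemma quat_add0 : left_id quat_zero quat_add.
Proof. by case=> *; rewrite /quat_add /= !add0r. Qed.
Lemma quat_addN : left_inverse quat_zero quat_opp quat_add.
Proof. by case=> *; rewrite /quat_add /= !addNr. Qed.

HB.instance Definition _ :=
  GRing.isZmodule.Build H quat_addA quat_addC quat_add0 quat_addN.

Definition quat_one : H := Quat a b 1 0 0 0.

(* The bilinear extension of the table
   i^2 = a, j^2 = b, k^2 = -ab, ij = k = -ji, ik = a j = -ki, kj = b i = -jk,
   which associativity forces on the defining relations. *)
Definition quat_mul x y : H :=
  let: Quat x0 x1 x2 x3 := x in
  let: Quat y0 y1 y2 y3 := y in
  Quat a b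
    (x0 * y0 + a * (x1 * y1) + b * (x2 * y2) - a * b * (x3 * y3))
    (x0 * y1 + x1 * y0 + b * (x3 * y2 - x2 * y3))
    (x0 * y2 + x2 * y0 + a * (x1 * y3 - x3 * y1))
    (x0 * y3 + x3 * y0 + (x1 * y2 - x2 * y1)).

Lemma quat_mulA : associative quat_mul.
Proof. by case=> ? ? ? ? [? ? ? ?] [? ? ? ?]; congr Quat; ring. Qed.
Lemma quat_mul1l : left_id quat_one quat_mul.
Proof. by case=> *; congr Quat; ring. Qed.
Lemma quat_mul1r : right_id quat_one quat_mul.
Proof. by case=> *; congr Quat; ring. Qed.
Lemma quat_mulDl : left_distributive quat_mul quat_add.
Proof. by case=> ? ? ? ? [? ? ? ?] [? ? ? ?]; congr Quat => /=; ring. Qed.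
Lemma quat_mulDr : right_distributive quat_mul quat_add.
Proof. by case=> ? ? ? ? [? ? ? ?] [? ? ? ?]; congr Quat => /=; ring. Qed.
Lemma quat_oner_neq0 : quat_one != 0 :> H.
Proof. by apply/eqP => -[] /eqP; rewrite oner_eq0. Qed.

HB.instance Definition _ := GRing.Zmodule_isNzRing.Build H
  quat_mulA quat_mul1l quat_mul1r quat_mulDl quat_mulDr quat_oner_neq0.

Definition quat_scale (c : R) x : H :=
  Quat a b (c * qre x) (c * qim_i x) (c * qim_j x) (c * qim_k x).

Lemma quat_scaleA c d x : quat_scale c (quat_scale d x) = quat_scale (c * d) x.
Proof. by rewrite /quat_scale /= !mulrA. Qed.
Lemma quat_scale1 : left_id 1 quat_scale.
Proof. by case=> *; rewrite /quat_scale /= !mul1r. Qed.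
Lemma quat_scaleDr : right_distributive quat_scale +%R.
Proof. by move=> c x y; rewrite /quat_scale /= !mulrDr. Qed.
Lemma quat_scaleDl x : {morph quat_scale^~ x : c d / c + d}.
Proof. by move=> c d; rewrite /quat_scale !mulrDl. Qed.

HB.instance Definition _ := GRing.Zmodule_isLmodule.Build R H
  quat_scaleA quat_scale1 quat_scaleDr quat_scaleDl.

Lemma quat_scaleAl (c : R) x y : c *: (x * y) = c *: x * y.
Proof. by case: x y => ? ? ? ? [? ? ? ?]; congr Quat => /=; ring. Qed.
Lemma quat_scaleAr (c : R) x y : c *: (x * y) = x * (c *: y).
Proof. by case: x y => ? ? ? ? [? ? ? ?]; congr Quat => /=; ring. Qed.

HB.instance Definition _ := GRing.Lmodule_isLalgebra.Build R H quat_scaleAl.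
HB.instance Definition _ := GRing.Lalgebra_isAlgebra.Build R H quat_scaleAr.

Definition quat_i : H := Quat a b 0 1 0 0.
Definition quat_j : H := Quat a b 0 0 1 0.
Definition quat_k : H := Quat a b 0 0 0 1.

Lemma quat_ii : quat_i * quat_i = a%:A.
Proof. by congr Quat => /=; ring. Qed.
Lemma quat_jj : quat_j * quat_j = b%:A.
Proof. by congr Quat => /=; ring. Qed.
Lemma quat_ij : quat_i * quat_j = quat_k.
Proof. by congr Quat => /=; ring. Qed.
Lemma quat_ji : quat_j * quat_i = - quat_k.
Proof. by congr Quat => /=; ring. Qed.

Lemma quatE (x0 x1 x2 x3 : R) :
  x0%:A + x1 *: quat_i + x2 *: quat_j + x3 *: quat_k = Quat a b x0 x1 x2 x3.
Proof. by congr Quat => /=; ring. Qed.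

Definition fib_quat (n : nat) : H :=
  (fib n)%:R%:A + (fib n.+1)%:R *: quat_i
  + (fib n.+2)%:R *: quat_j + (fib n.+3)%:R *: quat_k.

End Quaternion.

(* Main.v *)
Require Import Defs.
From mathcomp Require Import all_boot all_order all_algebra.
From mathcomp Require Import all_classical.
From mathcomp Require Import ring zify.

Set Implicit Arguments.
Unset Strict Implicit.

Import GRing.Theory.
Local Open Scope classical_set_scope.
Local Open Scope card_scope.
Local Open Scope ring_scope.

(** Write [a] and [b] for two consecutive Fibonacci numbers.  The quaternion
    [F_n = a + b i + (a + b) j + (a + 2 b) k] has norm
    [a^2 + b^2 + (a + b)^2 + (a + 2 b)^2 = 3 (a^2 + 2 a b + 2 b^2)], which
    vanishes in characteristic 3.  A quaternion times its conjugate is its norm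
    ([quat_mul_conj]), so [F_n] is annihilated by its conjugate, which is
    nonzero because 3 cannot divide both [a] and [b] ([fib_quat_neq0]).

    For the count, [F_n] is determined by the pair [(a, b)] modulo 3, and
    conversely its first two coordinates recover that pair.  The Fibonacci
    sequence modulo 3 has period 8 ([fib_add8_mod3]) and the eight pairs met
    during a period are distinct ([fib_pair_mod3_inj]); hence [F] has period 8
    and is injective on the first eight indices. *)

Lemma fibSS n : fib n.+2 = (fib n.+1 + fib n)%N.
Proof. by []. Qed.

Lemma fib_add8_mod3 n : fib (n + 8) = fib n %[mod 3].
Proof.
(* Unfolding the recurrence gives f_(n+8) = 21 f_(n+1) + 13 f_n, where 21 = 0
   and 13 = 1 modulo 3. *)
rewrite !addnS addn0 !fibSS; lia.
Qed.

(** The first eight pairs of consecutive terms run through all the nonzero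
    pairs modulo 3, each of them once; comparing them is a finite evaluation. *)
Lemma fib_pair_mod3_inj m n : (m < 8)%N -> (n < 8)%N ->
  fib m = fib n %[mod 3] -> fib m.+1 = fib n.+1 %[mod 3] -> m = n.
Proof. by do 8?[case: m => [|m] //]; do 8?[case: n => [|n] //]. Qed.

(** Two consecutive multiples of 3 would, by running the recurrence backwards,
    force 3 to divide [f_1 = 1]. *)
Lemma fib_pair_mod3_neq0 n : ~ ((3 %| fib n) && (3 %| fib n.+1))%N.
Proof. by elim: n => [|n IHn] //; rewrite fibSS; lia. Qed.

Lemma eqF3_nat (m n : nat) : (m%:R = n%:R :> 'F_3) <-> (m = n %[mod 3])%N.
Proof.
split=> [/(congr1 val) | eq_mn].
  by rewrite /= !val_Fp_nat.
by apply: val_inj; rewrite /= !val_Fp_nat.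
Qed.

Definition quat_conj (R : comNzRingType) (a b : R) (x : quaternion a b) :
    quaternion a b :=
  Quat a b (qre x) (- qim_i x) (- qim_j x) (- qim_k x).

Definition quat_norm (R : comNzRingType) (a b : R) (x : quaternion a b) : R :=
  qre x ^+ 2 - a * qim_i x ^+ 2 - b * qim_j x ^+ 2 + a * b * qim_k x ^+ 2.

Lemma quat_mul_conj (R : comNzRingType) (a b : R) (x : quaternion a b) :
  x * quat_conj x = (quat_norm x)%:A.
Proof. by case: x => ? ? ? ?; congr Quat; rewrite /quat_norm /=; ring. Qed.

Lemma quat_conjK (R : comNzRingType) (a b : R) :
  involutive (@quat_conj R a b).
Proof. by case=> ? ? ? ?; rewrite /quat_conj /= !opprK. Qed.

Lemma quat_conj0 (R : comNzRingType) (a b : R) :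
  quat_conj (0 : quaternion a b) = 0.
Proof. by congr Quat => /=; rewrite oppr0. Qed.

Lemma quat_norm_eq0_zero_divisor (R : comNzRingType) (a b : R)
    (x : quaternion a b) :
  x != 0 -> quat_norm x = 0 -> zero_divisor x.
Proof.
move=> x_neq0 Nx0; exists (quat_conj x); split.
  by apply: contra_neq x_neq0 => cx0; rewrite -[x]quat_conjK cx0 quat_conj0.
by left; rewrite quat_mul_conj Nx0 scale0r.
Qed.

Lemma fib_quatE (R : comNzRingType) (a b : R) n :
  fib_quat a b n =
  Quat a b (fib n)%:R (fib n.+1)%:R (fib n.+2)%:R (fib n.+3)%:R.
Proof. exact: quatE. Qed.

Lemma quat_norm_fib_quat (R : comNzRingType) n :
  quat_norm (fib_quat (-1 : R) (-1) n) =
  3%:R * ((fib n)%:R ^+ 2 + 2%:R * (fib n)%:R * (fib n.+1)%:R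
          + 2%:R * (fib n.+1)%:R ^+ 2).
Proof. by rewrite fib_quatE /quat_norm !fibSS /= !natrD; ring. Qed.

Lemma fib_quat_neq0 (a b : 'F_3) n : fib_quat a b n != 0.
Proof.
apply/eqP; rewrite fib_quatE => -[f0 f1 _ _].
apply: (@fib_pair_mod3_neq0 n).
by apply/andP; split; apply/eqP/(eqF3_nat _ 0).
Qed.

Lemma fib_quat_add8 (a b : 'F_3) n : fib_quat a b (n + 8) = fib_quat a b n.
Proof.
by rewrite !fib_quatE -!addSn; congr Quat; apply/eqF3_nat/fib_add8_mod3.
Qed.

Lemma fib_quat_mod8 (a b : 'F_3) n : fib_quat a b (n %% 8) = fib_quat a b n.
Proof.
rewrite [in RHS](divn_eq n 8) addnC.
by elim: (n %/ 8)%N => [|q IHq]; rewrite ?addn0 // mulSnr addnA fib_quat_add8.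
Qed.

Lemma fib_quat_inj8 (a b : 'F_3) : {in `I_8 &, injective (fib_quat a b)}.
Proof.
move=> m n; rewrite !inE /= => m_lt8 n_lt8; rewrite !fib_quatE.
by case=> /eqF3_nat eq0 /eqF3_nat eq1 _ _; apply: fib_pair_mod3_inj.
Qed.

Theorem proposition2p2 :
  (forall n : nat, zero_divisor (fib_quat (-1 : 'F_3) (-1) n)) /\
  range (fun n : nat => fib_quat (-1 : 'F_3) (-1) n) #= `I_8.
Proof.
split=> [n|].
  apply: quat_norm_eq0_zero_divisor; first exact: fib_quat_neq0.
  by rewrite quat_norm_fib_quat pchar_Fp_0 // mul0r.
have -> : range (fib_quat (-1 : 'F_3) (-1)) = fib_quat (-1) (-1) @` `I_8.
  apply/seteqP; split=> _ [n _ <-]; last by exists n.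
  by exists (n %% 8)%N; [exact: ltn_pmod | exact: fib_quat_mod8].
exact/inj_card_eq/fib_quat_inj8.
Qed.
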